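(* Let $\mathcal M$ be a loop-free matroid of rank $r$ with $m$ elements, and let $\mathfrak E_{\mathcal M}$ be its tautological tropical toric vector bundle over the permutahedral variety $X_m$. Then $\mathfrak E_{\mathcal M}$ is nef, in the sense that for every toric curve $C_\tau\subset X_m$ the restriction $\mathfrak E_{\mathcal M}|_{C_\tau}$ is equivalent to the bundle $\mathcal O(1)\oplus\mathcal O_{\mathbb P^1}\oplus\dots\oplus\mathcal O_{\mathbb P^1}$ or $\mathcal O_{\mathbb P^1}\oplus\dots\oplus\mathcal O_{\mathbb P^1}$ (with $r$ summands) over $C_\tau\cong\mathbb P^1$.
   Context: Bergman fan and apartments. For a loop-free matroid $\mathcal M$ of rank $r$, $\operatorname{Berg}(\mathcal M)\subset\mathbb R^{\mathcal M}$ is the set of $w$ such that for every circuit $C$ the minimum $\min_{i\in C}w_i$ is attained at least twice (equivalently, all sets $\{i:w_i\ge t\}$ are flats). For a basis $B$, the apartment $A_B$ is the set of $w\in\operatorname{Berg}(\mathcal M)$ for which $\sum_{b\in B}w_b$ is maximal among all bases; projection to the $B$-coordinates identifies $A_B$ with $\mathbb R^B$. Tautological bundle. $\Sigma_m$ is the complete fan in $\mathbb R^m$ (with lineality space $\mathbb R(1,\dots,1)$) whose maximal cones are $\{w:w_{\pi(1)}\ge\dots\ge w_{\pi(m)}\}$, $\pi\in S_m$. $X_m$ is the toric variety of its image in $\mathbb R^m/\mathbb R(1,\dots,1)$, with $T=\mathbb G_m^m$ acting through its quotient by the diagonal. $\mathfrak E_{\mathcal M}$ is given by $\Phi=\Phi_{\mathcal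 M}:\mathbb R^m\to\operatorname{Berg}(\mathcal M)$, $\Phi(w)_e=\sup\{k:e\in\operatorname{span}\{j:w_j\ge k\}\}$ (span = matroid closure); each coordinate of $\Phi$ is linear on every cone of $\Sigma_m$. Bundles on toric curves. Let $\tau$ be a codimension-one cone of $\Sigma_m$, $\sigma,\sigma'$ the two maximal cones containing it, $C_\tau\cong\mathbb P^1$ the corresponding toric curve, and $\eta_\tau\in\mathbb Z^m$ the primitive generator of $\tau^\perp$ that is nonnegative on $\sigma$. A $T$-equivariant tropical bundle on $C_\tau$ is a pair $(\mathcal N,\Psi)$ with $\mathcal N$ a loop-free matroid and $\Psi:\mathbb R^m\to\operatorname{Berg}(\mathcal N)$, sending integral points to integral points, such that each half-space $\{\eta_\tau\ge0\}$, $\{\eta_\tau\le0\}$ is mapped into a single apartment, linearly in its coordinates. The line bundle $\mathcal O(a)$ (with some $T$-linearization) is given by a one-element matroid of rank one and a function $\Psi$ equal to integral linear forms $u_+$ on $\{\eta_\tau\ge0\}$ and $u_-$ on $\{\eta_\tau\le0\}$ with $u_+-u_-=a\eta_\tau$; a direct sum of $r$ such bundles is given by the free matroid $U_{r,r}$ with the corresponding coordinate functions. Here $\mathcal O_{\mathbb P^1}=\mathcal O(0)$. A matroid extension $\phi:\mathcal N_1\to\mathcal N_2$ is an injection of ground sets of matroids of equal rank such that the matroid induced by $\mathcal N_2$ on $\phi(\mathcal N_1)$ is $\mathcal N_1$; it induces $\phi_*:\operatorname{Berg}(\mathcal N_1)\to\operatorname{Berg}(\mathcal N_2)$, $(\phi_*w)_e=\sup\{t:e\in\operatorname{span}\phi(\{i:w_i\ge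 t\})\}$. Equivalence of bundles is the equivalence relation generated by $(\mathcal N_1,\Psi)\sim(\mathcal N_2,\phi_*\circ\Psi)$. Restriction to $C_\tau$. Fix $x$ in the relative interior of $\tau$. $\mathfrak E_{\mathcal M}|_{C_\tau}$ is the pair $(\mathcal M_x,\Psi_\tau)$, where $\mathcal M_x$ is the matroid whose bases are the bases $B$ of $\mathcal M$ maximizing $\sum_{b\in B}\Phi(x)_b$, and $\Psi_\tau(y)=\lim_{\varepsilon\to0^+}(\Phi(x+\varepsilon y)-\Phi(x))/\varepsilon$. This is independent of $x$. *)

(* Defs.v *)
From HB Require Import structures.
From mathcomp Require Import all_boot all_order all_algebra all_fingroup.
From mathcomp Require Import all_classical all_reals all_analysis.

Set Implicit Arguments.
Unset Strict Implicit.
Unset Printing Implicit Defensive.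

Import Order.TTheory GRing.Theory Num.Theory.
Import numFieldNormedType.Exports.

Local Open Scope classical_set_scope.
Local Open Scope ring_scope.

Record matroid (E : finType) := Matroid {
  bases : {set {set E}};
  bases_neq0 : bases != finset.set0;
  bases_exchange : forall (B1 B2 : {set E}) (e : E),
    B1 \in bases -> B2 \in bases -> e \in (B1 :\: B2)%SET ->
    exists2 f, f \in (B2 :\: B1)%SET & (f |: (B1 :\ e))%SET \in bases }.

Section MatroidNotions.
Variables (E : finType) (M : matroid E).
Implicit Types (A B C : {set E}) (e : E).

Definition indep A : bool := [exists B in bases M, A \subset B].

Definition rk A : nat := (\max_(B in bases M) #|(A :&: B)%SET|)%N.

Definition mrank : nat := rk (finset.setTfor E).

(* Matroid closure. *)
Definition mspan A : {set E} := [set e | rk (e |: A) == rk A]%SET.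

Definition circuit C : bool := minset (fun A : {set E} => ~~ indep A) C.

Definition loopless : Prop := forall e, indep [set e]%SET.

End MatroidNotions.

(* Symmetric exchange is what makes the bases of maximal weight satisfy the
   exchange axiom. *)
Section SymmetricExchange.
Variables (E : finType) (M : matroid E).
Local Open Scope set_scope.

Lemma basis_extend (I B1 B2 : {set E}) :
  B1 \in bases M -> I \subset B1 -> B2 \in bases M ->
  exists B3, [/\ B3 \in bases M, I \subset B3 & B3 \subset I :|: B2].
Proof.
move=> hB1 hI hB2.
case: (@arg_maxnP _ B1 [pred B in bases M | I \subset B]
         (fun B : {set E} => #|B :&: B2|)) => [|B /andP[hB hIB] Bmax].
  by rewrite inE hB1.
exists B; split=> //; apply/fintype.subsetP => g gB.
case: (boolP (g \in I :|: B2)) => // gN.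
have [gNI gNB2] : g \notin I /\ g \notin B2.
  by move: gN; rewrite inE negb_or => /andP[].
have gD : g \in B :\: B2 by rewrite inE gNB2.
have [f] := bases_exchange hB hB2 gD; rewrite inE => /andP[fNB fB2] hB'.
have /Bmax : [pred B in bases M | I \subset B] (f |: (B :\ g)).
  rewrite inE hB' /=; apply/fintype.subsetP => i iI.
  rewrite !inE (fintype.subsetP hIB) // andbT.
  by apply/orP; right; apply: contraNneq gNI => <-.
have -> : (f |: B :\ g) :&: B2 = f |: (B :&: B2).
  apply/setP => z; rewrite !inE; have [->|_] /= := eqVneq z f.
    by rewrite fB2.
  by have [->|_] /= := eqVneq z g; rewrite ?(negPf gNB2) ?andbF.
by rewrite cardsU1 inE (negPf fNB) /= add1n ltnn.
Qed.

Lemma symmetric_exchange (B1 B2 : {set E}) e :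
  B1 \in bases M -> B2 \in bases M -> e \in B1 :\: B2 ->
  exists f, [/\ f \in B2 :\: B1, f |: (B1 :\ e) \in bases M
              & e |: (B2 :\ f) \in bases M].
Proof.
move=> hB1 hB2 eD; have := eD; rewrite inE => /andP[eNB2 eB1].
pose D := [set f in B2 | e |: (B2 :\ f) \in bases M].
have DB2 : D \subset B2 by apply/fintype.subsetP => f; rewrite inE => /andP[].
have [B3 [hB3 DB3 B3D]] := basis_extend hB2 DB2 hB1.
have eNB3 : e \notin B3.
  apply/negP => eB3.
  have hS : e |: D \subset B3 by rewrite finset.subUset finset.sub1set eB3.
  have [B4 [hB4 DB4 B4D]] := basis_extend hB3 hS hB2.
  have eB4 : e \in B4 by apply: (fintype.subsetP DB4); rewrite !inE eqxx.
  have eD4 : e \in B4 :\: B2 by rewrite inE eNB2.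
  have [f fD _] := bases_exchange hB4 hB2 eD4.
  have [g] := bases_exchange hB2 hB4 fD.
  rewrite inE => /andP[gNB2 gB4] hg.
  have ge : g = e.
    have := fintype.subsetP B4D g gB4; rewrite !inE (negPf gNB2) orbF.
    by case/orP => [/eqP //|/andP[]].
  move: fD; rewrite inE => /andP[/negP fNB4 fB2]; apply: fNB4.
  by apply: (fintype.subsetP DB4); rewrite !inE fB2 -ge hg orbT.
have eD3 : e \in B1 :\: B3 by rewrite inE eNB3.
have [f] := bases_exchange hB1 hB3 eD3.
rewrite inE => /andP[fNB1 fB3] hf.
have := fintype.subsetP B3D f fB3; rewrite !inE (negPf fNB1) orbF.
by case/andP => fB2 hf2; exists f; split; rewrite // inE fNB1.
Qed.

End SymmetricExchange.

Section Degeneration.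
Variables (R : realType) (E : finType) (M : matroid E) (w : E -> R).

Definition weight (B : {set E}) : R := \sum_(b in B) w b.

Definition max_basis (B : {set E}) : bool :=
  (B \in bases M) && [forall B' in bases M, weight B' <= weight B].

Let mbases : {set {set E}} := [set B | max_basis B]%SET.

Fact max_bases_neq0 : mbases != finset.set0.
Proof.
have [B0 hB0] := set0Pn _ (bases_neq0 M).
apply/set0Pn.
case: (@Order.TotalTheory.arg_maxP _ _ _ B0 (fun B => B \in bases M) weight hB0)
  => B hB Bmax.
exists B; rewrite inE /max_basis hB /=.
by apply/forall_inP => B' /Bmax.
Qed.

Lemma weight_swap (B : {set E}) e f : e \in B -> f \notin B ->
  weight (f |: (B :\ e))%SET = weight B - w e + w f.
Proof.
move=> eB fB; rewrite /weight big_setU1 /=; last first.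
  by rewrite !inE (negPf fB) andbF.
by rewrite (big_setD1 e eB) /= [w e + _]addrC addrK addrC.
Qed.

Fact max_bases_exchange (B1 B2 : {set E}) (e : E) :
  B1 \in mbases -> B2 \in mbases -> e \in (B1 :\: B2)%SET ->
  exists2 f, f \in (B2 :\: B1)%SET & (f |: (B1 :\ e))%SET \in mbases.
Proof.
rewrite !inE => /andP[hB1 /forall_inP m1] /andP[hB2 /forall_inP m2] eD.
have eD' : e \in (B1 :\: B2)%SET by rewrite inE.
have [f [fD h1 h2]] := symmetric_exchange hB1 hB2 eD'.
exists f => //; rewrite inE /max_basis h1 /=.
move: fD eD; rewrite inE => /andP[fN fB] /andP[eN eB].
have := m2 _ h2; rewrite weight_swap // => hw.
apply/forall_inP => B /m1 /le_trans; apply; rewrite weight_swap //.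
have fe : w e <= w f by rewrite -(lerD2l (weight B2 - w f)) subrK.
by rewrite -addrA lerDl addrC subr_ge0.
Qed.

Definition max_weight_matroid : matroid E :=
  Matroid max_bases_neq0 max_bases_exchange.

End Degeneration.

Section FreeMatroid.
Variable E : finType.

(* This is U_{r,r} with r = #|E|. *)
Let fbases : {set {set E}} := [set finset.setTfor E]%SET.

Fact free_bases_neq0 : fbases != finset.set0.
Proof. by apply/set0Pn; exists (finset.setTfor E); rewrite inE. Qed.

Fact free_bases_exchange (B1 B2 : {set E}) (e : E) :
  B1 \in fbases -> B2 \in fbases -> e \in (B1 :\: B2)%SET ->
  exists2 f, f \in (B2 :\: B1)%SET & (f |: (B1 :\ e))%SET \in fbases.
Proof. by rewrite !inE => /eqP-> /eqP->; rewrite !inE. Qed.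

Definition free_matroid : matroid E :=
  Matroid free_bases_neq0 free_bases_exchange.

End FreeMatroid.

Section Bergman.
Variables (R : realType) (E : finType) (M : matroid E).

Definition Berg : set (E -> R) :=
  [set w | forall C : {set E}, circuit M C ->
     exists i j, [/\ i \in C, j \in C, i != j, w i = w j
                   & forall k, k \in C -> w i <= w k]].

Definition apartment (B : {set E}) : set (E -> R) :=
  [set w | Berg w /\ max_basis M w B].

Definition Phi (w : E -> R) (e : E) : R :=
  sup [set k : R | e \in mspan M [set j | k <= w j]%SET].

End Bergman.

Definition extension (E1 E2 : finType) (N1 : matroid E1) (N2 : matroid E2)
    (phi : E1 -> E2) : Prop :=
  [/\ injective phi, mrank N1 = mrank N2
    & forall A : {set E1}, indep N1 A = indep N2 (finset.imset phi (mem A))].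

Definition ext_push (R : realType) (E1 E2 : finType) (N2 : matroid E2)
    (phi : E1 -> E2) (w : E1 -> R) (e : E2) : R :=
  sup [set t : R |
    e \in mspan N2 (finset.imset phi (mem [set i | t <= w i]%SET))].

Section Fan.
Variables (R : realType) (m : nat).
Implicit Types (S tau sigma : set 'rV[R]_m) (eta : 'rV[int]_m).

Definition dot (u w : 'rV[R]_m) : R := \sum_j u 0 j * w 0 j.

Definition realvec eta : 'rV[R]_m := map_mx intr eta.

Definition perm_cone (p : 'S_m) : set 'rV[R]_m :=
  [set w | forall i j : 'I_m, (i <= j)%N -> w 0 (p j) <= w 0 (p i)].

Definition maximal_cone sigma : Prop := exists p, sigma = perm_cone p.

Definition face tau sigma : Prop :=
  exists2 u : 'rV[R]_m, (forall w, sigma w -> 0 <= dot u w)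
    & tau = [set w | sigma w /\ dot u w = 0].

(* The linear span of S has dimension d: the rows of A are elements of S
   forming a basis of that span. *)
Definition span_dim S (d : nat) : Prop :=
  exists A : 'M[R]_(d, m),
    [/\ row_free A, forall i, S (row i A) & forall w, S w -> (w <= A)%MS].

Definition codim1_cone tau : Prop :=
  (exists2 sigma, maximal_cone sigma & face tau sigma) /\
  (exists2 d, m = d.+1 & span_dim tau d).

Definition affine_hull S : set 'rV[R]_m :=
  [set y | exists (n : nat) (c : 'I_n -> R) (s : 'I_n -> 'rV[R]_m),
     [/\ forall i, S (s i), \sum_i c i = 1 & y = \sum_i c i *: s i]].

(* Interior of S relative to its affine hull. *)
Definition relint S : set 'rV[R]_m :=
  [set x | S x /\ \forall y \near x, affine_hull S y -> S y].

Definition primitive eta : Prop :=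
  forall (k : int) (v : 'rV[int]_m), eta = k *: v -> `|k| = 1.

(* tau^\perp is the line through [eta]; among the two primitive vectors of that
   line, [eta] is the one that is nonnegative on [sigma]. *)
Definition primitive_normal tau sigma eta : Prop :=
  [/\ primitive eta,
      forall u : 'rV[R]_m,
        (forall w, tau w -> dot u w = 0) <-> exists c : R, u = c *: realvec eta
    & forall w, sigma w -> 0 <= dot (realvec eta) w].

End Fan.

(* A toric curve enters the definition of a bundle only through the primitive
   normal vector [eta] of its cone.  A prebundle is a pair (matroid, map) on
   which no condition is imposed; see [is_bundle]. *)
Record prebundle (R : realType) (m : nat) := Prebundle {
  ground : finType;
  bmatroid : matroid ground;
  bmap : 'rV[R]_m -> ground -> R }.

Arguments bmatroid {R m} p.
Arguments bmap {R m} p.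

Section Bundles.
Variables (R : realType) (m : nat) (eta : 'rV[int]_m).
Local Notation etaR := (realvec R eta).

Definition linear_in_apartment (E : finType) (N : matroid E)
    (Psi : 'rV[R]_m -> E -> R) (H : set 'rV[R]_m) : Prop :=
  exists2 B : {set E}, B \in bases N &
    (forall y, H y -> apartment N B (Psi y)) /\
    exists u : E -> 'rV[R]_m,
      forall b y, b \in B -> H y -> Psi y b = dot (u b) y.

Definition is_bundle (P : prebundle R m) : Prop :=
  let N := bmatroid P in
  let Psi := bmap P in
  [/\ loopless N,
      forall y, Berg N (Psi y),
      forall y : 'rV[R]_m, (forall j, y 0 j \is a Num.int) ->
        forall e, Psi y e \is a Num.int,
      linear_in_apartment N Psi [set y | 0 <= dot etaR y]
    & linear_in_apartment N Psi [set y | dot etaR y <= 0]].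

(* All constructors require bundles, so that this is the equivalence relation
   generated on the collection of bundles, and related pairs are bundles. *)
Inductive bundle_equiv : prebundle R m -> prebundle R m -> Prop :=
| bundle_equiv_ext (E1 E2 : finType) (N1 : matroid E1) (N2 : matroid E2)
    (Psi : 'rV[R]_m -> E1 -> R) (phi : E1 -> E2) :
    extension N1 N2 phi ->
    is_bundle (Prebundle N1 Psi) ->
    is_bundle (Prebundle N2 (fun y => ext_push N2 phi (Psi y))) ->
    bundle_equiv (Prebundle N1 Psi)
      (Prebundle N2 (fun y => ext_push N2 phi (Psi y)))
| bundle_equiv_refl P : is_bundle P -> bundle_equiv P P
| bundle_equiv_sym P Q : bundle_equiv P Q -> bundle_equiv Q P
| bundle_equiv_trans P Q S :
    bundle_equiv P Q -> bundle_equiv Q S -> bundle_equiv P S.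

(* [psi] is the function of O(a) for some T-linearization. *)
Definition line_bundle_fun (a : int) (psi : 'rV[R]_m -> R) : Prop :=
  exists up um : 'rV[int]_m,
    [/\ up - um = a *: eta,
        forall y, 0 <= dot etaR y -> psi y = dot (realvec R up) y
      & forall y, dot etaR y <= 0 -> psi y = dot (realvec R um) y].

(* [P] is O(a_0) + ... + O(a_(r-1)) for some T-linearizations. *)
Definition is_line_bundle_sum (r : nat) (a : 'I_r -> int) (P : prebundle R m)
    : Prop :=
  exists2 psi : 'I_r -> 'rV[R]_m -> R,
    forall i, line_bundle_fun (a i) (psi i)
    & P = Prebundle (free_matroid 'I_r) (fun y i => psi i y).

End Bundles.

(* The map is the one-sided directional derivative of [Phi M] at [x]. *)
Definition restriction (R : realType) (m : nat) (M : matroid 'I_m)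
    (x : 'rV[R]_m) : prebundle R m :=
  Prebundle (max_weight_matroid M (Phi M (x 0)))
    (fun y e =>
       lim ((Phi M ((x + eps *: y) 0) e - Phi M (x 0) e) / eps
            @[eps --> (0 : R)^'+])).

(* Main.v *)
Require Import Defs.
From mathcomp Require Import all_boot all_order all_algebra all_fingroup.
From mathcomp Require Import all_classical all_reals all_analysis.
From mathcomp Require Import zify lra.

(** Near a point [x] of a wall [tau] the whole tautological map is governed by
    one basis.  By the relative interior condition and primitivity of [eta],
    the coordinates of [x] are distinct except for one pair [x a = x b], and
    [eta] is [e_a - e_b] up to sign ([wall_structure]).  Order the ground set
    by decreasing [x], with [a] just before [b], and let [B] be the greedy
    basis: every element of the fundamental circuit of [e] over [B] comes no
    later than [e] ([greedy_basis]).

    A vector [v] on [B] extends to the apartment of [B] by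
    [e |-> min of v over the fundamental circuit of e]
    ([extend_apartment]).  For [w] close to [x] the vector [Phi w] is such an
    extension ([Phi_extend]): its values on [B] are the coordinates of [w],
    except that when [b] may replace [a] in [B] the value at [a] is
    [max (w a) (w b)] ([wall_coord]), since the greedy basis changes from [B]
    to [B - a + b] across the wall.  Differentiating a minimum of affine
    functions leaves the minimum over the elements where [x] is minimal, and
    these form the fundamental circuit in the initial matroid.  So the
    restricted bundle is again the extension from [B] of the coordinates
    [y j], one of which may have turned into [max (y a) (y b)]
    ([Phi_derivative]).

    Extending from [B] is exactly the push-forward along the inclusion of the
    free matroid on [B] ([ext_push_extend]), so the restriction is equivalent
    to the sum of the line bundles given by these functions.  A coordinate is
    linear and gives O(0); the function [max (y a) (y b)] bends by [e_a - e_b]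
    across the wall and gives O(1). *)

Set Implicit Arguments.
Unset Strict Implicit.
Unset Printing Implicit Defensive.

Import Order.TTheory GRing.Theory Num.Theory.
Import numFieldNormedType.Exports.

Local Open Scope classical_set_scope.
Local Open Scope ring_scope.

(** * Fundamental circuits and closure *)

Section MatroidTheory.
Import mathcomp.boot.fintype mathcomp.boot.finset.
Variables (E : finType) (M : matroid E).
Implicit Types (A B C : {set E}) (e : E).
Local Open Scope nat_scope.
Local Open Scope set_scope.

(** For [e] outside the basis [B] this is the fundamental circuit of [e] with
    [e] removed; for [e] in [B] it is the singleton of [e].  The two cases share
    one formula, so that [e] is always spanned by [fundamental B e]. *)
Definition fundamental B e : {set E} :=
  [set b in B | e |: (B :\ b) \in bases M].

Lemma bases_card B1 B2 :
  B1 \in bases M -> B2 \in bases M -> #|B1| = #|B2|.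
Proof.
move: {2}_.+1 (ltnSn #|B1 :\: B2|) => n.
elim: n => // n IHn in B1 B2 *; rewrite ltnS => le_n hB1 hB2.
have [D0|[e eD]] := set_0Vmem (B1 :\: B2).
  have [D0'|[f fD]] := set_0Vmem (B2 :\: B1).
    have /eqP -> // : B1 == B2 by rewrite eqEsubset -!setD_eq0 D0 D0' eqxx.
  by have [g] := bases_exchange hB2 hB1 fD; rewrite D0 inE.
have [f fD hB] := bases_exchange hB1 hB2 eD.
move: (eD) (fD); rewrite !inE => /andP[eB2 eB1] /andP[fB1 fB2].
rewrite -(IHn _ _ _ hB hB2).
  by rewrite cardsU1 !inE (negPf fB1) andbF (cardsD1 e B1) eB1.
apply: leq_trans le_n; rewrite (cardsD1 e (B1 :\: B2)) eD ltnS.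
apply/subset_leq_card/subsetP => z; rewrite !inE.
by have [->|_] := eqVneq z f; rewrite ?fB2 //=;
  case: (z == e); case: (z \in B1); case: (z \in B2).
Qed.

Lemma leq_rk A B : B \in bases M -> #|A :&: B| <= rk M A.
Proof. by move=> hB; rewrite /rk; apply: (bigop.bigmax_sup B). Qed.

Lemma rk_attained A : exists2 B, B \in bases M & #|A :&: B| = rk M A.
Proof.
have [B0 hB0] := set0Pn _ (bases_neq0 M).
have : 0 < #|[pred B in bases M]| by apply/card_gt0P; exists B0.
by case/(eq_bigmax_cond (fun B => #|A :&: B|)) => B hB hr; exists B.
Qed.

Lemma leq_rk_card A : rk M A <= #|A|.
Proof.
by have [B _ <-] := rk_attained A; apply/subset_leq_card/subsetIl.
Qed.

Lemma rk_subset A A' : A \subset A' -> rk M A <= rk M A'.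
Proof.
move=> sA; have [B hB <-] := rk_attained A.
by apply: leq_trans (leq_rk A' hB); apply/subset_leq_card/setSI.
Qed.

Lemma rk_indep_card A B : B \in bases M -> A \subset B -> rk M A = #|A|.
Proof.
move=> hB sAB; apply/eqP; rewrite eqn_leq leq_rk_card /=.
by rewrite -{1}(setIidPl sAB) leq_rk.
Qed.

(** Independence augmentation: completing [A :&: B] to a basis inside its union
    with a basis that meets [A'] maximally must use a new element of [A'], by a
    count. *)
Lemma augment A B A' :
  B \in bases M -> #|A :&: B| < rk M A' ->
  exists f, exists2 B3, B3 \in bases M &
    [/\ f \in A', f \notin A :&: B & f |: (A :&: B) \subset B3].
Proof.
move=> hB; have [B1 hB1 <-] := rk_attained A' => lt.
have [B3 [hB3 sI sB3]] := basis_extend hB (subsetIr A B) hB1.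
have [/pred0P D0|/pred0Pn[f]] :=
    boolP [disjoint B3 & (A' :&: B1) :\: (A :&: B)].
  have: B3 \subset (A :&: B) :|: (B1 :\: A').
    apply/subsetP => z zB; have := subsetP sB3 z zB.
    have := D0 z; rewrite /= !inE zB /=.
    by case: (z \in A); case: (z \in B); case: (z \in A'); case: (z \in B1).
  move/subset_leq_card; rewrite (bases_card hB3 hB1) => le3.
  have {}le3 := leq_trans le3 (leq_card_setU _ _).
  by have := cardsID A' B1; rewrite [B1 :&: _]setIC; lia.
rewrite /= => /andP[fB3 /setDP[/setIP[fA' fB1] fI]].
exists f; exists B3 => //; split=> //.
by rewrite subUset sub1set fB3.
Qed.

Lemma rk_lt_adjoin A B B3 f : #|A :&: B| = rk M A -> B3 \in bases M ->
  f \notin A :&: B -> f |: (A :&: B) \subset B3 -> rk M A < rk M (f |: A).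
Proof.
move=> hA hB3 fI sB3; apply: leq_trans (leq_rk _ hB3).
rewrite -hA; apply: leq_trans (_ : #|f |: (A :&: B)| <= _).
  by rewrite cardsU1 fI.
by apply: subset_leq_card; rewrite subsetI sB3 setUS ?subsetIl.
Qed.

(** A basis meeting [A] maximally decides which elements [A] spans.  If some [b]
    of the fundamental circuit lies outside [A], then exchanging [b] for [e]
    raises the rank of [A]; conversely an [e] raising the rank extends
    [A :&: B] and, completed from [B], replaces some [b] outside [A].  The
    closure axioms follow by choosing one basis adapted to all sets involved. *)
Lemma mspan_adapted A B e : B \in bases M -> #|A :&: B| = rk M A ->
  (e \in mspan M A) = (fundamental B e \subset A).
Proof.
move=> hB hA; rewrite inE; apply/eqP/subsetP => [he b | hC].
  rewrite inE => /andP[bB hB']; apply: contraT => bA.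
  have := leq_rk (e |: A) hB'; rewrite he -hA leqNgt => /negP[].
  apply: proper_card; apply/properP; split.
    apply/subsetP => z; rewrite !inE => /andP[zA ->].
    rewrite zA !orbT andbT; have [zb|_] := eqVneq z b; last by rewrite orbT.
    by rewrite -zb zA in bA.
  exists e; first by rewrite !inE eqxx.
  apply/negP; rewrite inE => /andP[eA eB].
  have eb : e != b by apply: contraNneq bA => <-.
  have := bases_card hB' hB; rewrite cardsU1 !inE eB eb /= => hc.
  by have := cardsD1 b B; rewrite bB -hc; lia.
apply/eqP; rewrite eqn_leq [X in _ && X]rk_subset ?andbT; last exact: subsetU1.
rewrite leqNgt -hA; apply/negP => /(augment hB)[f [B3 hB3 [fA fI sB3]]].
have fNA : f \notin A.
  apply/negP => fA'; have := rk_lt_adjoin hA hB3 fI sB3.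
  by rewrite (setUidPr _) ?ltnn // sub1set.
have fe : f = e by move: fA; rewrite inE (negPf fNA) orbF => /set1P.
subst f => {fA}.
have eNB : e \notin B.
  apply: contra fNA => eB; apply: hC.
  by rewrite inE eB setD1K.
have [B4 [hB4 sI4 sB4]] := basis_extend hB3 sB3 hB.
have [b bB bB4] : exists2 b, b \in B & b \notin B4.
  apply/subsetPn/negP => sBB4.
  (* otherwise B4 = B would contain e *)
  have /eqP EB : B == B4 by rewrite eqEcard sBB4 (bases_card hB4 hB) /=.
  by case/negP: eNB; rewrite EB; apply: (subsetP sI4); rewrite !inE eqxx.
have bA : b \in A.
  apply: hC; rewrite inE bB /=.
  suff <- : B4 = e |: (B :\ b) by [].
  apply/eqP; rewrite eqEcard cardsU1 !inE (negPf eNB) andbF /=.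
  rewrite (bases_card hB4 hB).
  rewrite (cardsD1 b B) bB leqnn andbT.
  apply/subsetP => z zB4; have := subsetP sB4 z zB4; rewrite !inE.
  have [zb|_] := eqVneq z b; first by rewrite -zb zB4 in bB4.
  by case: (z == e); case: (z \in A); case: (z \in B).
case/negP: bB4; apply: (subsetP sI4).
by rewrite !inE bA bB orbT.
Qed.

Lemma mspan_basis A B e : B \in bases M -> A \subset B ->
  (e \in mspan M A) = (fundamental B e \subset A).
Proof.
move=> hB sAB; apply: mspan_adapted => //.
by rewrite (setIidPl sAB) (rk_indep_card hB).
Qed.

Lemma sub_mspan A : A \subset mspan M A.
Proof.
apply/subsetP => e eA; rewrite inE.
by rewrite (setUidPr _) // sub1set.
Qed.

Lemma mspan_mono A A' : A \subset A' -> mspan M A \subset mspan M A'.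
Proof.
move=> sAA'; have [B hB hA] := rk_attained A.
have [B1 hB1 hA'] := rk_attained A'.
have [B2 [hB2 sI sB2]] := basis_extend hB (subsetIr A B) hB1.
(* B2 contains A :&: B and takes its other elements from B1, so it meets both
   A and A' maximally *)
have hA2 : #|A :&: B2| = rk M A.
  apply/eqP; rewrite eqn_leq leq_rk //= -hA; apply: subset_leq_card.
  by rewrite subsetI subsetIl.
have hA2' : #|A' :&: B2| = rk M A'.
  apply/eqP; rewrite eqn_leq leq_rk //= -hA'.
  have /subset_leq_card : B2 :\: A' \subset B1 :\: A'.
    apply/subsetP => z; rewrite !inE => /andP[zA' zB2].
    have := subsetP sB2 z zB2; rewrite !inE zA' /=.
    by case/orP => // /andP[/(subsetP sAA')]; rewrite (negPf zA').
  have := cardsID A' B1; have := cardsID A' B2.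
  rewrite (bases_card hB2 hB1) ![_ :&: A']setIC; lia.
apply/subsetP => e.
rewrite (mspan_adapted e hB2 hA2) (mspan_adapted e hB2 hA2') => /subset_trans.
exact.
Qed.

Lemma mspan_idem A : mspan M (mspan M A) \subset mspan M A.
Proof.
have [B hB hA] := rk_attained A.
have hr : rk M (mspan M A) = rk M A.
  apply/eqP; rewrite eqn_leq [X in _ && X]rk_subset ?sub_mspan //.
  rewrite andbT leqNgt -hA.
  apply/negP => /(augment hB)[f [B3 hB3 [fA fI sB3]]].
  have := rk_lt_adjoin hA hB3 fI sB3.
  by move: fA; rewrite inE => /eqP ->; rewrite ltnn.
have hS : #|mspan M A :&: B| = rk M (mspan M A).
  apply/eqP; rewrite eqn_leq leq_rk // hr -hA.
  by apply: subset_leq_card; apply: setSI (sub_mspan A).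
have EI : mspan M A :&: B = A :&: B.
  by apply/esym/eqP; rewrite eqEcard setSI ?sub_mspan //= hS hr hA.
apply/subsetP => e.
rewrite (mspan_adapted e hB hS) (mspan_adapted e hB hA) => sC.
suff : fundamental B e \subset A :&: B by rewrite subsetI => /andP[].
rewrite -EI subsetI sC; apply/subsetP => b.
by rewrite inE => /andP[].
Qed.

Lemma mspan_sub A A' : A \subset mspan M A' -> mspan M A \subset mspan M A'.
Proof. by move/mspan_mono/subset_trans; apply; apply: mspan_idem. Qed.

Lemma fundamental_sub B e : fundamental B e \subset B.
Proof. by apply/subsetP => b; rewrite inE => /andP[]. Qed.

Lemma fundamental_id B b :
  B \in bases M -> b \in B -> fundamental B b = [set b].
Proof.
move=> hB bB; apply/setP => c; rewrite !inE.
have [->|cb] := eqVneq c b; first by rewrite bB setD1K.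
apply/andP => -[cB /bases_card/(_ hB)].
rewrite (setUidPr _) ?sub1set ?inE 1?eq_sym ?cb //.
by have := cardsD1 c B; rewrite cB; lia.
Qed.

Lemma fundamental_neq0 B e :
  loopless M -> B \in bases M -> exists b, b \in fundamental B e.
Proof.
move=> hL hB; apply/set0Pn; apply/eqP => C0.
have : e \in mspan M set0.
  by rewrite (mspan_basis e hB) ?sub0set // C0 sub0set.
have /exists_inP[B1 hB1 sB1] := hL e.
rewrite inE setU0 (rk_indep_card hB1 sB1).
by rewrite (rk_indep_card hB1) ?sub0set // cards1 cards0.
Qed.

Lemma circuit_mspan C i : circuit M C -> i \in C -> i \in mspan M (C :\ i).
Proof.
move=> /minsetP[depC minC] iC.
have indC : indep M (C :\ i).
  apply: contraT => /minC/(_ (subD1set _ _)) EC.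
  by move: iC; rewrite -EC !inE eqxx.
have /exists_inP[B hB sB] := indC.
rewrite inE setD1K // eqn_leq [X in _ && X]rk_subset ?subD1set // andbT.
rewrite (rk_indep_card hB sB); have [B1 hB1 <-] := rk_attained C.
have := cardsD1 i C; rewrite iC add1n => hc.
rewrite -ltnS -hc; apply: proper_card; rewrite properEneq subsetIl andbT.
apply: contraNneq depC => /setIidPl sC.
by apply/exists_inP; exists B1.
Qed.

Lemma mrank_basis B : B \in bases M -> mrank M = #|B|.
Proof.
move=> hB; rewrite /mrank; have [B1 hB1 <-] := rk_attained [set: E].
by rewrite setTI (bases_card hB1 hB).
Qed.

End MatroidTheory.

(** * Minimum over a finite set, maximal bases and apartments *)

Section SetMin.
Variables (R : realType) (E : finType).
Implicit Types (C : {set E}) (w : E -> R).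

(** Taken as a supremum to match the shape of [Phi] and [ext_push]; it is the
    minimum as soon as [C] is nonempty. *)
Definition setmin C w : R := sup [set t : R | forall b, b \in C -> t <= w b].

Lemma setminE C w b0 :
  b0 \in C -> (forall b, b \in C -> w b0 <= w b) -> setmin C w = w b0.
Proof.
move=> b0C minb; apply/eqP; rewrite eq_le; apply/andP; split.
  by apply: ge_sup => [|t /(_ _ b0C)//]; exists (w b0).
by apply: ub_le_sup => //; exists (w b0) => t /(_ _ b0C).
Qed.

Lemma setmin_attained C w : (exists b, b \in C) ->
  exists2 b0, b0 \in C & setmin C w = w b0 /\ forall b, b \in C -> w b0 <= w b.
Proof.
case=> c cC.
case: (Order.TotalTheory.arg_minP w cC) => b0 b0C minb.
by exists b0 => //; split=> //; apply: setminE.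
Qed.

Lemma setmin_le C w b : b \in C -> setmin C w <= w b.
Proof.
move=> bC; have [|b0 _ [-> minb]] := @setmin_attained C w; first by exists b.
exact: minb.
Qed.

Lemma le_setmin C w t : (exists b, b \in C) ->
  (t <= setmin C w) <-> (forall b, b \in C -> t <= w b).
Proof.
move=> C0; split=> [le b bC|le]; first exact: le_trans le (setmin_le _ bC).
by have [b0 b0C [-> _]] := setmin_attained w C0; apply: le.
Qed.

Lemma setmin1 b w : setmin [set b]%SET w = w b.
Proof. by apply: setminE => [|c]; rewrite inE // => /eqP->. Qed.

End SetMin.

Section Weights.
Variables (R : realType) (E : finType) (M : matroid E) (B : {set E}).
Hypotheses (M_loopless : loopless M) (hB : B \in bases M).
Implicit Types (w v : E -> R) (e : E).
Import mathcomp.boot.fintype mathcomp.boot.finset.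
Local Open Scope set_scope.

(** Local optimality is global for matroids: symmetric exchange moves any basis
    towards [B] one element at a time without lowering its weight. *)
Lemma max_basis_local w :
  (forall e b, b \in fundamental M B e -> w e <= w b) -> max_basis M w B.
Proof.
move=> loc; rewrite /max_basis hB /=; apply/forall_inP => B' hB'.
move: {2}_.+1 (ltnSn #|B' :\: B|) => n.
elim: n => // n IHn in B' hB' *; rewrite ltnS => le_n.
have [D0|[e eD]] := set_0Vmem (B' :\: B).
  have /eqP -> // : B' == B.
  by rewrite eqEcard -setD_eq0 D0 eqxx (bases_card hB hB') /=.
have [f [fD h1 h2]] := symmetric_exchange hB' hB eD.
move: (eD) (fD); rewrite !inE => /andP[eB eB'] /andP[fB' fB].
apply: le_trans (IHn _ h1 _).
  rewrite weight_swap // -addrA lerDl addrC subr_ge0 loc //.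
  by rewrite inE fB h2.
apply: leq_trans le_n; rewrite (cardsD1 e (B' :\: B)) eD ltnS.
apply/subset_leq_card/subsetP => z; rewrite !inE.
have [->|_] := eqVneq z f; first by rewrite fB.
by case: (z == e); case: (z \in B); case: (z \in B').
Qed.

Lemma max_basis_swap w e b :
  max_basis M w B -> b \in fundamental M B e -> w e <= w b.
Proof.
move=> /andP[_ /forall_inP maxB]; have [eB|eB] := boolP (e \in B).
  by rewrite fundamental_id // inE => /eqP->.
rewrite inE => /andP[bB /maxB]; rewrite weight_swap //.
by rewrite -addrA gerDl addrC subr_le0.
Qed.

(** Among the bases [e |: B :\ b], those of maximal weight are the ones whose
    exchange does not change the weight.  This is how the initial matroid sees
    only the minimizers on a fundamental circuit. *)
Lemma fundamental_max_weight w e : max_basis M w B ->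
  fundamental (max_weight_matroid M w) B e =
    [set b in fundamental M B e | w b == w e].
Proof.
move=> mB; have [_ /forall_inP maxB] := andP mB.
have [eB|eB] := boolP (e \in B).
  rewrite !fundamental_id //; last by rewrite inE.
  apply/setP => b; rewrite !inE.
  by have [->|] := eqVneq b e; rewrite ?eqxx.
apply/setP => b; rewrite !inE /max_basis -andbA; case bB: (b \in B) => //=.
case hb: (_ \in bases M) => //=.
have le : w e <= w b by apply: max_basis_swap mB _; rewrite inE bB.
apply/forall_inP/eqP => [/(_ B hB)|ebw B' /maxB].
  rewrite weight_swap // -addrA lerDl addrC subr_ge0 => ge.
  by apply/eqP; rewrite eq_le le ge.
by rewrite weight_swap // ebw subrK.
Qed.

(** If the minimum over a circuit were attained only at [i], the rest of the
    circuit would lie in a superlevel set that is closed but misses [i],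
    although the rest spans [i]. *)
Lemma flats_Berg w :
  (forall t, mspan M [set j | t <= w j] \subset [set j | t <= w j]) -> Berg M w.
Proof.
move=> flat C cC.
have depC : ~~ indep M C by case/minsetP: cC.
have [i0 i0C] : exists i, i \in C.
  apply/set0Pn; apply: contraNneq depC => ->.
  by apply/exists_inP; exists B; rewrite ?sub0set.
case: (Order.TotalTheory.arg_minP w i0C) => i iC mini.
have [j0 j0C] : exists j, j \in C :\ i.
  apply/set0Pn; apply: contraNneq depC => C1.
  by rewrite -(setD1K iC) C1 setU0; apply: M_loopless.
case: (Order.TotalTheory.arg_minP w j0C) => j jC minj.
have /setD1P[ji jC'] : j \in C :\ i by [].
exists i, j; split=> //; first by rewrite eq_sym.
apply/eqP; rewrite eq_le mini //=.
have := circuit_mspan cC iC.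
have sC : C :\ i \subset [set k | w j <= w k].
  by apply/subsetP => k /minj; rewrite inE.
by move/(subsetP (mspan_mono M sC))/(subsetP (flat _)); rewrite inE.
Qed.

(** The inverse of the projection of the apartment of [B] to its
    [B]-coordinates. *)
Definition extend v e : R := setmin (fundamental M B e) v.

(** The superlevel sets of the extension are closures of superlevel sets of [v]
    on [B]; both membership in the Bergman fan and the comparison with [Phi] and
    [ext_push] are read off from this. *)
Lemma le_extend v t e :
  (t <= extend v e) = (e \in mspan M [set b in B | t <= v b]).
Proof.
rewrite (mspan_basis e hB); last by apply/subsetP => b; rewrite inE => /andP[].
have ex := fundamental_neq0 e M_loopless hB.
apply/idP/subsetP => [/(le_setmin _ _ ex) le b bC|sC].
  by rewrite inE le // (subsetP (fundamental_sub M B e)).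
by apply/le_setmin => // b /sC; rewrite inE => /andP[].
Qed.

Lemma extend_basis v b : b \in B -> extend v b = v b.
Proof. by move=> bB; rewrite /extend fundamental_id // setmin1. Qed.

Lemma extend_apartment v : apartment M B (extend v).
Proof.
split.
  apply: flats_Berg => t.
  have -> : [set j | t <= extend v j] = mspan M [set b in B | t <= v b].
    by apply/setP => e; rewrite inE le_extend.
  exact: mspan_idem.
apply: max_basis_local => e b bC.
by rewrite [extend v b]extend_basis ?setmin_le //
  (subsetP (fundamental_sub M B e)).
Qed.

End Weights.

(** * Bundles obtained from a basis *)

Lemma sup_eq (R : realType) (P : set R) (c : R) :
  (forall t, P t <-> t <= c) -> sup P = c.
Proof.
move=> hP; apply/eqP; rewrite eq_le; apply/andP; split.
  by apply: ge_sup => [|t /hP//]; exists c; apply/hP.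
by apply: ub_le_sup; [exists c => t /hP|apply/hP].
Qed.

(** Both sides have the same superlevel sets, the closures of those of [v] on the
    basis.  This is what ties bundles on the free matroid to bundles whose image
    lies in one apartment. *)
Lemma ext_push_extend (R : realType) (I E : finType) (N : matroid E)
    (phi : I -> E) (v : E -> R) :
  loopless N -> finset.imset phi (mem (finset.setTfor I)) \in bases N ->
  ext_push N phi (fun i => v (phi i)) =
  extend N (finset.imset phi (mem (finset.setTfor I))) v.
Proof.
move=> hN hB; apply/funext => e; apply: sup_eq => t /=.
rewrite (le_extend hN hB).
suff -> : finset.imset phi (mem [set i | t <= v (phi i)]%SET) =
  [set b in finset.imset phi (mem (finset.setTfor I)) | t <= v b]%SET by [].
apply/setP => b; rewrite inE; apply/imsetP/andP => [[i]|[/imsetP[i _ ->] le]].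
  by rewrite inE => le ->; rewrite imset_f ?inE.
by exists i; rewrite ?inE.
Qed.

Lemma free_extension (I E : finType) (N : matroid E) (phi : I -> E) :
  injective phi -> finset.imset phi (mem (finset.setTfor I)) \in bases N ->
  extension (free_matroid I) N phi.
Proof.
move=> phi_inj hB; split=> // [|A].
  rewrite (mrank_basis hB) card_imset //.
  rewrite (@mrank_basis _ _ (finset.setTfor I)) //.
  by rewrite inE.
transitivity true; [|symmetry]; apply/exists_inP.
  by exists (finset.setTfor I); rewrite ?inE ?finset.subsetT.
exists (finset.imset phi (mem (finset.setTfor I))) => //.
by apply: imsetS; apply: finset.subsetT.
Qed.

Section Bundles.
Variables (R : realType) (m : nat) (eta : 'rV[int]_m).

Lemma dot_int (u : 'rV[int]_m) (y : 'rV[R]_m) :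
  (forall j, y 0 j \is a Num.int) -> dot (realvec R u) y \is a Num.int.
Proof.
by move=> hy; apply: rpred_sum => j _; rewrite mxE rpredM // intr_int.
Qed.

(** The apartment of [B] contains the whole image, so [B] serves on both
    half-spaces, and only the coordinates on [B] have to be checked. *)
Lemma bundle_extend (E : finType) (N : matroid E) (B : {set E})
    (v : 'rV[R]_m -> E -> R) :
  loopless N -> B \in bases N ->
  (forall b, b \in B -> exists a, line_bundle_fun eta a (fun y => v y b)) ->
  is_bundle eta (Prebundle N (fun y => extend N B (v y))).
Proof.
move=> hN hB hv.
have [up hup] : {up : E -> 'rV[int]_m & forall b, b \in B -> forall y,
    0 <= dot (realvec R eta) y -> v y b = dot (realvec R (up b)) y}.
  apply: (choice (P := fun b u => b \in B -> forall y,
    0 <= dot (realvec R eta) y -> v y b = dot (realvec R u) y)) => b.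
  have [/hv[a [u [_ [_ hu _]]]]|] := boolP (b \in B); first by exists u.
  by exists 0.
have [um hum] : {um : E -> 'rV[int]_m & forall b, b \in B -> forall y,
    dot (realvec R eta) y <= 0 -> v y b = dot (realvec R (um b)) y}.
  apply: (choice (P := fun b u => b \in B -> forall y,
    dot (realvec R eta) y <= 0 -> v y b = dot (realvec R u) y)) => b.
  have [/hv[a [_ [u [_ _ hu]]]]|] := boolP (b \in B); first by exists u.
  by exists 0.
split=> //= [y|y hy e||].
- by have [] := extend_apartment hN hB (v y).
- rewrite /extend.
  have [b bC [-> _]] := setmin_attained (v y) (fundamental_neq0 e hN hB).
  have bB := fintype.subsetP (fundamental_sub N B e) b bC.
  have [h|/ltW h] := leP 0 (dot (realvec R eta) y).
    by rewrite (hup b bB y h) dot_int.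
  by rewrite (hum b bB y h) dot_int.
- exists B => //; split=> [y _|]; first exact: extend_apartment.
  exists (fun b => realvec R (up b)) => b y bB h.
  by rewrite extend_basis // hup.
exists B => //; split=> [y _|]; first exact: extend_apartment.
exists (fun b => realvec R (um b)) => b y bB h.
by rewrite extend_basis // hum.
Qed.

(** One push-forward suffices: [phi] includes the free matroid as a basis, and
    the bundle on it with coordinates [v y (phi i)] is a sum of line bundles. *)
Lemma extend_equiv_sum (E : finType) (N : matroid E) (r : nat)
    (phi : 'I_r -> E) (v : 'rV[R]_m -> E -> R) (a : 'I_r -> int) :
  loopless N -> injective phi ->
  finset.imset phi (mem (finset.setTfor 'I_r)) \in bases N ->
  (forall i, line_bundle_fun eta (a i) (fun y => v y (phi i))) ->
  exists2 P, is_line_bundle_sum eta a P & bundle_equiv eta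
    (Prebundle N (fun y =>
       extend N (finset.imset phi (mem (finset.setTfor 'I_r))) (v y))) P.
Proof.
move=> hN phi_inj hB ha.
exists (Prebundle (free_matroid 'I_r) (fun y i => v y (phi i))).
  by exists (fun i y => v y (phi i)).
have hF : finset.setTfor 'I_r \in bases (free_matroid 'I_r) by rewrite inE.
have lF : loopless (free_matroid 'I_r).
  move=> i; apply/exists_inP.
  by exists (finset.setTfor 'I_r); rewrite ?finset.subsetT.
apply: bundle_equiv_sym.
have -> : (fun y =>
    extend N (finset.imset phi (mem (finset.setTfor 'I_r))) (v y)) =
    (fun y => ext_push N phi (fun i => v y (phi i))).
  by apply/funext => y; rewrite ext_push_extend.
apply: bundle_equiv_ext.
- exact: free_extension.
- have -> : (fun y i => v y (phi i)) =
    (fun y => extend (free_matroid 'I_r) (finset.setTfor 'I_r)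
       (fun i => v y (phi i))).
    by apply/funext => y; apply/funext => i; rewrite extend_basis ?inE.
  by apply: bundle_extend => // b _; exists (a b); apply: ha.
have -> : (fun y => ext_push N phi (fun i => v y (phi i))) = (fun y =>
    extend N (finset.imset phi (mem (finset.setTfor 'I_r))) (v y)).
  by apply/funext => y; rewrite ext_push_extend.
by apply: bundle_extend => // _ /imsetP[i _ ->]; exists (a i); apply: ha.
Qed.

End Bundles.

(** * The tautological map near a wall *)

(** The greedy basis for the order [g], found as a basis of maximal weight for
    [- g]. *)
Lemma greedy_basis (R : realType) (E : finType) (M : matroid E) (g : E -> nat) :
  exists2 B, B \in bases M &
    forall e c, c \in fundamental M B e -> (g c <= g e)%N.
Proof.
have [B] := set0Pn _ (max_bases_neq0 M (fun e => - (g e)%:R : R)).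
rewrite inE => mB; have hB : B \in bases M by case/andP: mB.
exists B => // e c /(max_basis_swap hB mB).
by rewrite lerN2 ler_nat.
Qed.

Lemma near_lt_perturb (R : realType) (s t u v : R) : s < t ->
  \forall eps \near (0 : R)^'+, s + eps * u < t + eps * v.
Proof.
move=> st; have d0 : 0 < 1 + `|u - v| by rewrite ltr_pwDl.
near=> eps.
have e0 : 0 < eps by near: eps; exact: nbhs_right_gt.
have : eps < (t - s) / (1 + `|u - v|).
  by near: eps; apply: nbhs_right_lt; rewrite divr_gt0 ?subr_gt0.
rewrite ltr_pdivlMr // => lt.
have : eps * (u - v) <= eps * `|u - v| by rewrite ler_pM2l // ler_norm.
lra.
Unshelve. all: by end_near. Qed.

Lemma near_order_perturb (R : realType) (E : finType) (x y : E -> R) :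
  \forall eps \near (0 : R)^'+,
    forall i j, x i < x j -> x i + eps * y i < x j + eps * y j.
Proof.
apply: filter_forall => i; apply: filter_forall => j.
have [lt|le] := ltP (x i) (x j); last by near=> eps.
by apply: filterS (near_lt_perturb (y i) (y j) lt) => eps + _.
Unshelve. all: by end_near. Qed.

(** One-sided derivative of a minimum of affine functions: among the minimizers
    at [x], the direction [y] selects those where [y] is smallest, and the
    others stay larger for small [eps]. *)
Lemma near_setmin_perturb (R : realType) (E : finType) (C : {set E})
    (x y : E -> R) : (exists b, b \in C) ->
  \forall eps \near (0 : R)^'+, setmin C (fun b => x b + eps * y b) =
    setmin C x + eps * setmin [set b in C | x b == setmin C x]%SET y.
Proof.
move=> C0; have [b0 b0C [xb0 minx]] := setmin_attained x C0.
set C' := [set b in C | _]%SET.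
have [b1 b1C' [yb1 miny]] : exists2 b1, b1 \in C' &
    setmin C' y = y b1 /\ forall b, b \in C' -> y b1 <= y b.
  by apply: setmin_attained; exists b0; rewrite inE b0C xb0 eqxx.
have := b1C'; rewrite inE => /andP[b1C /eqP xb1].
near=> eps.
have e0 : 0 < eps by near: eps; exact: nbhs_right_gt.
rewrite yb1 -xb1; apply: (setminE (w := fun b => x b + eps * y b) b1C) => b bC.
have [lt|le] := ltP (x b1) (x b).
  by apply/ltW; move: b1 b lt {b1C' yb1 miny b1C xb1 bC}; near: eps;
     exact: near_order_perturb.
have xb : x b = x b1 by apply/eqP; rewrite eq_le le xb1 xb0 minx.
rewrite xb lerD2l ler_pM2l // miny // inE bC xb xb1.
exact: eqxx.
Unshelve. all: by end_near. Qed.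

(** Here [x] is a general point of a wall, [g] the order of one of the two
    adjacent chambers, [a] and [b] the tied pair, and [B] the greedy basis for
    [g]. *)
Section Tautological.
Variables (R : realType) (E : finType) (M : matroid E) (B : {set E}).
Hypotheses (M_loopless : loopless M) (hB : B \in bases M).
Variables (x : E -> R) (g : E -> nat) (a b : E).
Hypotheses (g_inj : injective g) (lt_ab : (g a < g b)%N) (x_ab : x a = x b).
Hypothesis x_anti : forall i j, (g i < g j)%N -> x j <= x i.
Hypothesis x_inj : forall i j, (g i < g j)%N -> x i = x j -> i = a /\ j = b.
Hypothesis greedy : forall e c, c \in fundamental M B e -> (g c <= g e)%N.
Implicit Types (w y : E -> R) (e : E).
Import mathcomp.boot.fintype mathcomp.boot.finset.
Local Open Scope set_scope.

(** The coordinates on [B] of [Phi M y], for [y] that keeps the strict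
    inequalities of [x].  On the side where [y b > y a] the greedy basis is
    [B - a + b] if that is a basis, and then [a], being spanned by [b] and
    earlier elements, is reached at level [y b]. *)
Definition wall_coord y j : R :=
  if (j == a) && (a \in fundamental M B b) then Num.max (y a) (y b) else y j.

Lemma le_wall_coord y j : y j <= wall_coord y j.
Proof.
rewrite /wall_coord; case: eqP => //= ->.
by case: ifP; rewrite ?le_max ?lexx.
Qed.

Lemma wall_coord_at : wall_coord x = x.
Proof.
apply/funext => j; rewrite /wall_coord; case: eqP => //= ->.
by case: ifP => // _; rewrite -x_ab maxxx.
Qed.

Lemma wall_coord_perturb y (eps : R) : 0 <= eps ->
  wall_coord (fun j => x j + eps * y j) = (fun j => x j + eps * wall_coord y j).
Proof.
move=> e0; apply/funext => j; rewrite /wall_coord; case: eqP => //= ->.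
by case: ifP => // _; rewrite -x_ab maxr_pMr // addr_maxr.
Qed.

(** The upper set [U] of [w] is spanned by its trace on [B], because fundamental
    circuits go back in the order and the only inversion that [w] allows, of
    [a] and [b], is repaired by the maximum in [wall_coord].  Conversely the only
    element that may be added to the trace is [a], when [U] contains [b] but
    not [a]; its fundamental circuit over [B - a + b] lies in [U]. *)
Lemma mspan_upper w t : (forall i j, x i < x j -> w i < w j) ->
  mspan M [set j | t <= w j] = mspan M [set j in B | t <= wall_coord w j].
Proof.
move=> w_x; set U := [set j | _]; set A := [set j in B | _].
have AB : A \subset B by apply/subsetP => j; rewrite inE => /andP[].
have prev c e : (g c < g e)%N -> w e < w c \/ c = a /\ e = b.
  move=> lt; have := x_anti lt; rewrite le_eqVlt.
  case/orP=> [/eqP eqx|/w_x]; last by left.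
  by right; apply: x_inj.
apply/eqP; rewrite eqEsubset; apply/andP; split; apply: mspan_sub.
  apply/subsetP => e; rewrite inE => te; rewrite (mspan_basis e hB AB).
  apply/subsetP => c cC; rewrite inE (subsetP (fundamental_sub M B e)) //=.
  have := greedy cC; rewrite leq_eqVlt => /orP[/eqP/g_inj->|/prev[lt|[ca eb]]].
  - exact: le_trans te (le_wall_coord _ _).
  - exact: le_trans (le_trans te (ltW lt)) (le_wall_coord _ _).
  move: te cC; rewrite ca eb => te aC.
  by rewrite /wall_coord eqxx aC /= le_max te orbT.
apply/subsetP => j; rewrite inE => /andP[jB]; rewrite /wall_coord.
have [ja|_] /= := eqVneq j a; last first.
  by move=> tj; apply: (subsetP (sub_mspan M U)); rewrite inE.
have [aC|_] := ifPn; last first.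
  by move=> tj; apply: (subsetP (sub_mspan M U)); rewrite inE.
rewrite {}ja {j} le_max in jB * => /orP[ta|tb].
  by apply: (subsetP (sub_mspan M U)); rewrite inE.
have ab : a != b by apply: contraTneq lt_ab => ->; rewrite ltnn.
have bB : b \notin B.
  by apply: contraNN ab => bB; move: aC; rewrite fundamental_id // inE.
have hB' : b |: (B :\ a) \in bases M by move: aC; rewrite inE => /andP[].
(* b replaces a, so a is spanned by b and the rest of the circuit of b *)
suff sC : fundamental M (b |: (B :\ a)) a \subset U :&: (b |: (B :\ a)).
  apply: (subsetP (mspan_mono M (subsetIl U (b |: (B :\ a))))).
  by rewrite (mspan_basis a hB') ?subsetIr.
rewrite subsetI fundamental_sub andbT; apply/subsetP => c; rewrite inE.
case/andP; rewrite in_setU1 => /orP[/eqP-> _|]; first by rewrite inE.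
case/setD1P => ca cB hc.
have cb : c != b by apply: contraNneq bB => <-.
have : c \in fundamental M B b.
  rewrite inE cB /=; suff <- : a |: (b |: B :\ a) :\ c = b |: B :\ c by [].
  apply/setP => z; rewrite !inE; have [->|za] /= := eqVneq z a.
    by rewrite jB andbT [a == c]eq_sym ca orbT.
  by have [->|zb] /= := eqVneq z b; first by rewrite eq_sym cb.
move/greedy; rewrite leq_eqVlt => /orP[/eqP/g_inj cb'|/prev[lt|[ca' _]]].
- by rewrite cb' eqxx in cb.
- by rewrite inE (le_trans tb (ltW lt)).
by rewrite ca' eqxx in ca.
Qed.

Lemma Phi_extend w : (forall i j, x i < x j -> w i < w j) ->
  Phi M w = extend M B (wall_coord w).
Proof.
move=> w_x; apply/funext => e; apply: sup_eq => t /=.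
by rewrite (le_extend M_loopless hB) mspan_upper.
Qed.

Lemma Phi_at_x : Phi M x = extend M B x.
Proof. by rewrite Phi_extend // wall_coord_at. Qed.

Lemma max_basis_Phi : max_basis M (Phi M x) B.
Proof. by rewrite Phi_at_x; have [] := extend_apartment M_loopless hB x. Qed.

Lemma basis_initial : B \in bases (max_weight_matroid M (Phi M x)).
Proof. by rewrite inE max_basis_Phi. Qed.

Lemma fundamental_initial e : fundamental (max_weight_matroid M (Phi M x)) B e =
  [set c in fundamental M B e | x c == setmin (fundamental M B e) x].
Proof.
rewrite (fundamental_max_weight hB) ?max_basis_Phi //.
apply/setP => c; rewrite [LHS]inE [RHS]inE.
have [cC|//] := boolP (c \in fundamental M B e); rewrite /=.
by rewrite Phi_at_x extend_basis // (subsetP (fundamental_sub M B e)).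
Qed.

(** Exchanging [e] with a minimizer of [x] on its fundamental circuit keeps the
    weight, so [e] lies in a basis of maximal weight. *)
Lemma loopless_initial : loopless (max_weight_matroid M (Phi M x)).
Proof.
move=> e; have [c cC [xc minc]] :=
  setmin_attained x (fundamental_neq0 e M_loopless hB).
have : c \in fundamental (max_weight_matroid M (Phi M x)) B e.
  by rewrite fundamental_initial inE cC xc eqxx.
rewrite [X in is_true X -> _]inE => /andP[_ hc]; apply/exists_inP.
by exists (e |: (B :\ c)); rewrite // sub1set !inE eqxx.
Qed.

(** The difference quotient is constant for small [eps].  Its value involves only
    the minimizers of [x] on the fundamental circuit of [e], which are the
    fundamental circuit in the initial matroid. *)
Lemma Phi_derivative y e :
  lim ((Phi M (fun j => x j + eps * y j) e - Phi M x e) / eps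
    @[eps --> (0 : R)^'+])%classic =
  extend (max_weight_matroid M (Phi M x)) B (wall_coord y) e.
Proof.
apply: lim_near_cst; first exact: Rhausdorff.
have C0 := fundamental_neq0 e M_loopless hB.
near=> eps.
have e0 : 0 < eps by near: eps; exact: nbhs_right_gt.
rewrite Phi_extend; last by near: eps; exact: near_order_perturb.
have -> : Phi M x e = setmin (fundamental M B e) x by rewrite Phi_at_x.
rewrite (wall_coord_perturb _ (ltW e0)) /extend.
have -> : setmin (fundamental M B e) (fun j => x j + eps * wall_coord y j) =
   setmin (fundamental M B e) x +
     eps * setmin (fundamental (max_weight_matroid M (Phi M x)) B e)
       (wall_coord y).
  rewrite fundamental_initial; near: eps; exact: near_setmin_perturb.
by rewrite addrAC subrr add0r mulrC mulKf ?gt_eqF.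
Unshelve. all: by end_near. Qed.

End Tautological.

(** * Walls of the permutohedral fan *)

Section Fan.
Variables (R : realType) (m : nat).
Implicit Types (tau sigma : set 'rV[R]_m) (eta : 'rV[int]_m).

Lemma dotDZr (u v w : 'rV[R]_m) (c : R) :
  dot u (v + c *: w) = dot u v + c * dot u w.
Proof.
rewrite /dot mulr_sumr -big_split; apply: eq_bigr => j _.
by rewrite !mxE mulrDr mulrCA.
Qed.

Lemma dot_self0 (u : 'rV[R]_m) : dot u u <= 0 -> u = 0.
Proof.
move=> le; apply/rowP => j; rewrite mxE.
have ge k : 0 <= u 0 k * u 0 k by rewrite -expr2 sqr_ge0.
have /eqP : dot u u = 0 by apply/eqP; rewrite eq_le le sumr_ge0.
rewrite psumr_eq0 // => /allP/(_ j); rewrite mem_index_enum => /(_ isT)/eqP/eqP.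
by rewrite mulf_eq0 orbb => /eqP.
Qed.

Lemma dot_delta (j : 'I_m) (w : 'rV[R]_m) :
  dot (realvec R (delta_mx 0 j)) w = w 0 j.
Proof.
rewrite /dot (bigD1 j) //= !mxE !eqxx mul1r big1 ?addr0 // => k kj.
by rewrite !mxE eqxx (negPf kj) mul0r.
Qed.

Lemma dotBl (u v w : 'rV[R]_m) : dot (u - v) w = dot u w - dot v w.
Proof.
rewrite /dot -sumrB; apply: eq_bigr => j _.
by rewrite !mxE mulrBl.
Qed.

Lemma dot_delta_sub (i j : 'I_m) (w : 'rV[R]_m) :
  dot (realvec R (delta_mx 0 i - delta_mx 0 j)) w = w 0 i - w 0 j.
Proof. by rewrite /realvec map_mxB dotBl !dot_delta. Qed.

(** With distinct coordinates all inequalities of the chamber are strict. *)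
Lemma near_perm_cone (q : 'S_m) (x z : 'rV[R]_m) : perm_cone q x ->
  injective (x 0) ->
  \forall eps \near (0 : R)^'+, perm_cone q (x + eps *: z).
Proof.
move=> qx x_inj; apply: filterS (near_order_perturb (x 0) (z 0)) => eps h i j ij.
have [->//|nij] := eqVneq i j.
rewrite !mxE; apply/ltW/h; rewrite lt_neqAle qx // andbT.
by apply: contra_neq nij => /x_inj/perm_inj.
Qed.

Lemma cvg_ray (x z : 'rV[R]_m) : (x + d *: z) @[d --> (0 : R)^'+] --> x.
Proof.
(* in dimension 0 there is no norm, but then the claim is trivial *)
case: m => [|n] in x z *.
  apply: cvg_near_cst; near=> d; by apply/rowP => -[].
have E : x + (0 : R) *: z = x by rewrite scale0r addr0.
rewrite -[X in _ --> X]E.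
apply: cvgD; first exact: cvg_cst.
by apply: cvgZr_tmp; apply: cvg_at_right_filter; apply: cvg_id.
Unshelve. all: by end_near. Qed.

(** A relatively interior point can be moved slightly away from [w] without
    leaving [tau]; if [w] separated [i] and [j] while [x] does not, this move
    would reverse their order within one chamber. *)
Lemma relint_eq tau (q : 'S_m) (x w : 'rV[R]_m) (i j : 'I_m) :
  tau `<=` perm_cone q -> relint tau x -> tau w ->
  x 0 i = x 0 j -> w 0 i = w 0 j.
Proof.
move=> sub [tx near_x] tw.
wlog le_ij : i j / ((q^-1)%g i <= (q^-1)%g j)%N.
  by move=> hw xij; have [/hw|/ltnW/hw h] := leqP ((q^-1)%g i) ((q^-1)%g j);
    [apply|apply/esym/h].
have ord (y : 'rV[R]_m) : tau y -> y 0 j <= y 0 i.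
  by move=> /sub/(_ _ _ le_ij); rewrite !permKV.
move=> xij; apply/eqP; rewrite eq_le ord // andbT leNgt; apply/negP => lt.
have cv := @cvg_ray x (x - w).
have [d [d0]] : exists d : R, 0 < d /\ (affine_hull tau (x + d *: (x - w)) ->
    tau (x + d *: (x - w))).
  apply: (@filter_ex _ ((0 : R)^'+)).
  near=> d; split; first by near: d; exact: nbhs_right_gt.
  by near: d; exact: (cv _ near_x).
have hull : affine_hull tau (x + d *: (x - w)).
  exists 2, (fun k => if k == 0 then 1 + d else - d),
    (fun k => if k == 0 then x else w).
  split=> [k||]; first by case: ifP.
    by rewrite big_ord_recl big_ord1 /= addrK.
  by rewrite big_ord_recl big_ord1 /= scalerDl scale1r scalerBr scaleNr addrA.
move=> /(_ hull)/ord; rewrite !mxE xij lerD2l ler_pM2l // lerD2l lerN2.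
by rewrite leNgt lt.
Unshelve. all: by end_near. Qed.

(** If the coordinates of [x] were distinct, [x] would be interior to the
    chamber, forcing first the face functional [u] and then [eta] to vanish.  A
    tie of [x] at [k], [l] is a tie on all of [tau], so [e_k - e_l] lies on the
    line of [eta]; this leaves room for one tie only, and primitivity makes the
    factor a sign. *)
Lemma wall_structure tau sigma eta (x : 'rV[R]_m) :
  codim1_cone tau -> primitive_normal tau sigma eta -> relint tau x ->
  exists (g : 'I_m -> nat) (a b : 'I_m),
    [/\ injective g, (g a < g b)%N, x 0 a = x 0 b,
        forall i j, (g i < g j)%N -> x 0 j <= x 0 i
      & forall i j, (g i < g j)%N -> x 0 i = x 0 j -> i = a /\ j = b] /\
    (eta = delta_mx 0 a - delta_mx 0 b \/ eta = delta_mx 0 b - delta_mx 0 a).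
Proof.
move=> [[_ [q ->] [u u_ge tauE]] _] [prim perp _] rx.
have sub : tau `<=` perm_cone q by rewrite tauE => w [].
have tx : tau x by case: rx.
have eta0 : eta != 0.
  apply/negP => /eqP e0; have := prim 2 0; rewrite e0 scaler0 => /(_ erefl).
  by [].
pose g (i : 'I_m) : nat := (q^-1)%g i.
have g_inj : injective g by move=> i j /val_inj/perm_inj.
have x_anti i j : (g i < g j)%N -> x 0 j <= x 0 i.
  by move=> /ltnW /(sub _ tx); rewrite !permKV.
have perp_eta : forall w, tau w -> dot (realvec R eta) w = 0.
  by apply/perp; exists 1; rewrite scale1r.
have [i [j [lt_ij xij]]] : exists i j, (g i < g j)%N /\ x 0 i = x 0 j.
  apply: contrapT => noeq; case/negP: eta0; apply/eqP.
  have x_inj : injective (x 0).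
    move=> i j xij; have [lt|lt|/g_inj] := ltngtP (g i) (g j); last exact.
      by case: noeq; exists i, j; split; [exact: lt|exact: xij].
    by case: noeq; exists j, i; split; [exact: lt|exact/esym/xij].
  have u0 : u = 0.
    have [d [d0 hd]] : exists d : R, 0 < d /\ perm_cone q (x + d *: - u).
      apply: (@filter_ex _ ((0 : R)^'+)); near=> d.
      split; first by near: d; exact: nbhs_right_gt.
      by near: d; apply: near_perm_cone => //; exact: sub.
    apply: dot_self0; have := u_ge _ hd; move: tx; rewrite tauE => -[_ ux].
    rewrite scalerN -scaleNr dotDZr ux add0r mulNr oppr_ge0.
    by rewrite pmulr_rle0.
  have [d [d0 hd]] : exists d : R, 0 < d /\ perm_cone q (x + d *: realvec R eta).
    apply: (@filter_ex _ ((0 : R)^'+)); near=> d.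
    split; first by near: d; exact: nbhs_right_gt.
    by near: d; apply: near_perm_cone => //; exact: sub.
  have : dot (realvec R eta) (x + d *: realvec R eta) = 0.
    apply: perp_eta; rewrite tauE; split=> //.
    by rewrite u0 /dot big1 // => k _; rewrite mxE mul0r.
  rewrite dotDZr perp_eta // add0r => /eqP.
  rewrite mulf_eq0 gt_eqF //= => /eqP h.
  have /rowP eR := dot_self0 (eq_ind_r (fun t => t <= 0) (lexx 0) h).
  apply/rowP => k; have := eR k; rewrite !mxE => /eqP.
  by rewrite intr_eq0 => /eqP.
have pair k l : k != l -> x 0 k = x 0 l ->
    eta = eta 0 k *: (delta_mx 0 k - delta_mx 0 l).
  move=> kl xkl.
  have [c hc] : exists c : R,
      realvec R (delta_mx 0 k - delta_mx 0 l) = c *: realvec R eta.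
    by apply/perp => w tw; rewrite dot_delta_sub (relint_eq sub rx tw xkl) subrr.
  have hc' n : ((n == k)%:R - (n == l)%:R : R) = c * (eta 0 n)%:~R.
    by have /rowP/(_ n) := hc; rewrite !mxE eqxx /= rmorphB /= !rmorph_nat.
  have := hc' k; rewrite eqxx (negPf kl) subr0 => ck.
  have c0 : c != 0.
    by apply/eqP => c0; move: ck; rewrite c0 mul0r => /eqP; rewrite oner_eq0.
  apply/rowP => n; rewrite !mxE eqxx /=.
  apply: (@intr_inj R); apply: (mulfI c0).
  rewrite -hc' rmorphM /= mulrA -ck mul1r rmorphB /=.
  by rewrite !rmorph_nat.
have nij : i != j by apply: contraTneq lt_ij => ->; rewrite ltnn.
have eta_ij := pair i j nij xij.
exists g, i, j; split; [split=> // k l lt_kl xkl|].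
  have nkl : k != l by apply: contraTneq lt_kl => ->; rewrite ltnn.
  have ek := pair k l nkl xkl.
  have eta_i : eta 0 i != 0.
    by apply: contraNneq eta0 => z; rewrite eta_ij z scale0r.
  have eta_j : eta 0 j != 0.
    apply: contraNneq eta0 => z.
    by rewrite (pair j i _ (esym xij)) 1?eq_sym // z scale0r.
  have mem n : eta 0 n != 0 -> n = k \/ n = l.
    rewrite ek !mxE eqxx /=; have [->|_] := eqVneq n k; first by left.
    have [->|_] := eqVneq n l; first by right.
    by rewrite subrr mulr0 eqxx.
  move: lt_ij lt_kl nij.
  case: (mem i eta_i) => ->; case: (mem j eta_j) => ->; rewrite ?eqxx //.
  by move=> /ltnW; rewrite leqNgt => /negP lt /lt.
have := prim _ _ eta_ij.
case: (ger0P (eta 0 i)) => [_ e1|_ e1]; move: eta_ij.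
  by rewrite e1 scale1r; left.
move/eqP: e1; rewrite eqr_oppLR => /eqP ->.
by rewrite scaleN1r opprB; right.
Unshelve. all: by end_near. Qed.

Lemma line_bundle_coord eta (j : 'I_m) :
  line_bundle_fun eta 0 (fun y : 'rV[R]_m => y 0 j).
Proof.
exists (delta_mx 0 j), (delta_mx 0 j); split=> [|y _|y _]; rewrite ?dot_delta //.
by rewrite subrr scale0r.
Qed.

Lemma line_bundle_max eta (a b : 'I_m) :
  eta = delta_mx 0 a - delta_mx 0 b ->
  line_bundle_fun eta 1 (fun y : 'rV[R]_m => Num.max (y 0 a) (y 0 b)).
Proof.
move=> ->; exists (delta_mx 0 a), (delta_mx 0 b).
split=> [|y|y]; rewrite ?scale1r // dot_delta_sub dot_delta.
  by rewrite subr_ge0 => /max_idPl.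
by rewrite subr_le0 => /max_idPr.
Qed.

End Fan.

(** * Nefness *)

(** Puts a chosen element of the basis in position 0, the position of the
    summand O(1). *)
Lemma enum_basis_from (E : finType) (B : {set E}) (c : E) (r : nat) :
  c \in B -> #|B| = r -> exists phi : 'I_r -> E,
  [/\ injective phi, finset.imset phi (mem (finset.setTfor 'I_r)) = B
    & forall i, (phi i == c) = (i == 0%N :> nat)].
Proof.
move=> cB hr; pose s := c :: enum (B :\ c)%SET.
have us : uniq s by rewrite /= mem_enum !inE eqxx enum_uniq.
have zs : size s = r by rewrite /= -cardE -hr (cardsD1 c B) cB.
have phi_inj : injective (fun i : 'I_r => nth c s i).
  move=> i j /eqP; rewrite nth_uniq ?zs ?ltn_ord // => /eqP ij.
  exact: val_inj.
exists (fun i : 'I_r => nth c s i); split=> // [|i].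
  apply/eqP; rewrite eqEcard card_imset // cardsT card_ord hr leqnn andbT.
  apply/fintype.subsetP => _ /imsetP[i _ ->].
  have : nth c s i \in s by apply: mem_nth; rewrite zs.
  by rewrite inE mem_enum !inE => /orP[/eqP->|/andP[]].
have -> : (nth c s i == c) = (nth c s i == nth c s 0) by [].
by rewrite nth_uniq // zs ?(leq_ltn_trans _ (ltn_ord i)).
Qed.

Theorem theorem9p8 (R : realType) (m r : nat) (M : matroid 'I_m)
    (M_loopless : loopless M) (M_rank : mrank M = r)
    (tau : set 'rV[R]_m) (tau_codim1 : codim1_cone tau)
    (sigma : set 'rV[R]_m) (sigma_max : maximal_cone sigma)
    (tau_sigma : tau `<=` sigma)
    (eta : 'rV[int]_m) (eta_normal : primitive_normal tau sigma eta)
    (x : 'rV[R]_m) (x_relint : relint tau x) :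
  (exists2 P : prebundle R m,
     is_line_bundle_sum eta (fun i : 'I_r => if i == 0%N :> nat then 1 else 0) P
     & bundle_equiv eta (restriction M x) P) \/
  (exists2 P : prebundle R m,
     is_line_bundle_sum eta (fun i : 'I_r => 0) P
     & bundle_equiv eta (restriction M x) P).
Proof.
have [g [a [b [[g_inj lt_ab x_ab x_anti x_inj] etaE]]]] :=
  wall_structure tau_codim1 eta_normal x_relint.
have [B hB greedy] := greedy_basis R M g.
have cardB : #|B| = r by rewrite -M_rank (mrank_basis hB).
set N := max_weight_matroid M (Phi M (x 0)).
have hBN : B \in bases N by apply: (@basis_initial _ _ _ _ _ _ _ g a b).
have hN : loopless N by apply: (@loopless_initial _ _ _ B _ _ _ g a b).
have -> : restriction M x =
    Prebundle N (fun y => extend N B (wall_coord M B a b (y 0))).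
  rewrite /restriction; congr Prebundle; apply/funext => y; apply/funext => e.
  rewrite -(Phi_derivative M_loopless hB g_inj lt_ab x_ab x_anti x_inj greedy).
  apply: (congr1 (fun f : R -> R => lim (f @ (0 : R)^'+))).
  apply/funext => eps; congr ((Phi M _ e - _) / _).
  by apply/funext => j; rewrite !mxE.
have [aC|aC] := boolP (a \in fundamental M B b); [left|right].
  have [phi [phi_inj phiB phi0]] :=
    enum_basis_from (fintype.subsetP (fundamental_sub M B b) a aC) cardB.
  have := @extend_equiv_sum R m eta _ N r phi
    (fun y => wall_coord M B a b (y 0)).
  rewrite phiB; apply => // i; rewrite /wall_coord aC phi0 andbT.
  case: ifP => _; last exact: line_bundle_coord.
  case: etaE => etaE; first exact: line_bundle_max.
  have -> : (fun y : 'rV[R]_m => Num.max (y 0 a) (y 0 b)) =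
    (fun y => Num.max (y 0 b) (y 0 a)) by apply/funext => y; rewrite maxC.
  exact: line_bundle_max.
have [c cC] := fundamental_neq0 a M_loopless hB.
have [phi [phi_inj phiB _]] :=
  enum_basis_from (fintype.subsetP (fundamental_sub M B a) c cC) cardB.
have := @extend_equiv_sum R m eta _ N r phi (fun y => wall_coord M B a b (y 0)).
rewrite phiB; apply => // i; rewrite /wall_coord (negPf aC) andbF.
exact: line_bundle_coord.
Qed.
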